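(* Let $M$ be a countable locally finite structure such that algebraic closures of finite subsets of $M$ are finite, and let $G=\mathrm{Aut}(M)$. Suppose that, for some $n\geq 1$, the set of $n$-tuples in $G^n$ generating a non-precompact and non-discrete subgroup of $G$ is comeager in $G^n$. Then each topological $n$-similarity class in $G$ is meager in $G^n$.
   Context: A structure is a set with relations and functions; it is locally finite if all its finitely generated substructures are finite. $\mathrm{Aut}(M)$ carries the pointwise convergence topology ($M$ discrete), making it a Polish group. For finite $A\subseteq M$, $\mathrm{Aut}_A(M)$ is the pointwise stabilizer of $A$ in $\mathrm{Aut}(M)$, and the algebraic closure of $A$ is the set of all elements of $M$ whose orbit under the evaluation action of $\mathrm{Aut}_A(M)$ is finite. For an $n$-tuple $\bar f=(f_1,\ldots,f_n)$ in a topological group $G$, $\langle\bar f\rangle$ is the subgroup generated by $\{f_1,\ldots,f_n\}$. A subgroup is precompact if its closure in $G$ is compact, and discrete if its subspace topology is discrete. The topological $n$-similarity class of $\bar f$ (also called the $n$-dimensional class of topological similarity) is the set of all $\bar g=(g_1,\ldots,g_n)\in G^n$ such that the map $f_i\mapsto g_i$ extends (necessarily uniquely) to a bi-continuous group isomorphism between $\langle\bar f\rangle$ and $\langle\bar g\rangle$, taken with the subspace topologies. *)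

(* Defs.v *)
From HB Require Import structures.
From mathcomp Require Import all_boot all_order all_algebra.
From mathcomp Require Import all_classical topology.

Set Implicit Arguments.
Unset Strict Implicit.
Unset Printing Implicit Defensive.

Local Open Scope classical_set_scope.

Section Category.
Context {T : topologicalType}.
Implicit Type A : set T.

Definition nowhere_dense A := interior (closure A) = set0.

Definition meager A :=
  exists2 F : nat -> set T, (forall i, nowhere_dense (F i)) & A = \bigcup_i F i.

Definition comeager A := meager (~` A).

End Category.

HB.mixin Record isTopologicalGroup G of Group G & Topological G := {
  mulg_continuous : continuous (fun xy : G * G => (xy.1 * xy.2)%g);
  invg_continuous : continuous (fun x : G => (x^-1)%g)
}.

#[short(type="topGroupType")]
HB.structure Definition TopologicalGroup :=
  {G of Group G & Topological G & isTopologicalGroup G}.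

(* [subspace A] isolates the points outside [A], whereas
   [set_type A], used here through the coercion from sets to types, carries
   exactly the subspace topology. *)
Definition discrete_subset (T : topologicalType) (A : set T) :=
  forall U : set A, open U.

Section TopologicalSimilarity.
Context {G : topGroupType}.
Local Open Scope group_scope.

Definition is_subgroup (H : set G) :=
  [/\ H 1, forall x y, H x -> H y -> H (x * y) & forall x, H x -> H x^-1].

Definition gen_subgroup n (f : 'I_n -> G) : set G :=
  smallest is_subgroup (range f).

(* [phi] matters only on [A]: its values outside [A] are junk. *)
Definition bicontinuous_iso (A B : set G) (phi : G -> G) :=
  [/\ set_bij A B phi,
      {in A &, {morph phi : x y / x * y}},
      {within A, continuous phi} &
      exists2 psi : G -> G, {in A, cancel phi psi} & {within B, continuous psi}].

Definition similarity_class n (f : {ptws 'I_n -> G}) : set {ptws 'I_n -> G} :=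
  [set g | exists2 phi : G -> G,
     bicontinuous_iso (gen_subgroup f) (gen_subgroup g) phi &
     forall i, phi (f i) = g i].

End TopologicalSimilarity.

(* Function symbols of arity 0 (constants) are allowed. *)
Record structure (M : Type) := Structure {
  rel_symbol : Type;
  rel_arity : rel_symbol -> nat;
  rel_interp : forall r, set ('I_(rel_arity r) -> M);
  fun_symbol : Type;
  fun_arity : fun_symbol -> nat;
  fun_interp : forall s, ('I_(fun_arity s) -> M) -> M
}.

Section Structures.
Context {M : Type} (S : structure M).

Definition is_substructure (B : set M) :=
  forall (s : fun_symbol S) (t : 'I_(fun_arity s) -> M),
    (forall i, B (t i)) -> B (fun_interp t).

Definition gen_substructure (A : set M) : set M := smallest is_substructure A.

Definition locally_finite :=
  forall A : set M, finite_set A -> finite_set (gen_substructure A).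

Definition is_automorphism (g : M -> M) :=
  [/\ bijective g,
      forall (r : rel_symbol S) (t : 'I_(rel_arity r) -> M),
        rel_interp (g \o t) <-> rel_interp t &
      forall (s : fun_symbol S) (t : 'I_(fun_arity s) -> M),
        fun_interp (g \o t) = g (fun_interp t)].

Lemma id_is_automorphism : is_automorphism id.
Proof. by split=> //; exists id. Qed.

Lemma comp_is_automorphism g h :
  is_automorphism g -> is_automorphism h -> is_automorphism (g \o h).
Proof.
move=> [bg rg fg] [bh rh fh]; split; first exact: bij_comp.
- by move=> r t; rewrite -compA; apply: iff_trans (rg _ _) (rh _ _).
- by move=> s t; rewrite -compA fg fh.
Qed.

Lemma inv_is_automorphism g : is_automorphism g ->
  exists h, [/\ is_automorphism h, cancel g h & cancel h g].
Proof.
move=> [[h gK hK] rg fg]; exists h; split=> //; split; first by exists g.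
- move=> r t; apply: iff_trans (iff_sym (rg _ _)) _.
  by rewrite (_ : g \o (h \o t) = t)//; apply/funext => i; exact: hK.
- move=> s t; apply: (can_inj gK); rewrite hK -fg; congr fun_interp.
  by apply/funext => i; exact: hK.
Qed.

End Structures.

Definition autgroup (M : choiceType) (S : structure M) : Type :=
  set_type (is_automorphism S : set {ptws M -> discrete_topology M}).

HB.instance Definition _ (M : choiceType) (S : structure M) :=
  Topological.copy (autgroup S)
    (set_type (is_automorphism S : set {ptws M -> discrete_topology M})).

Section AutGroup.
Context {M : choiceType} {S : structure M}.
Local Notation G := (autgroup S).

Definition aut_fun (g : G) : M -> M := set_val g.

Lemma aut_funP (g : G) : is_automorphism S (aut_fun g).
Proof. exact: set_mem (valP g). Qed.

Lemma aut_eqP (g h : G) : aut_fun g =1 aut_fun h -> g = h.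
Proof. by move=> gh; apply: val_inj; apply/funext. Qed.

Definition aut_mk (g : M -> M) (gP : is_automorphism S g) : G :=
  exist _ (g : {ptws M -> discrete_topology M}) (mem_set gP).

Definition aut_one : G := aut_mk (id_is_automorphism S).

Definition aut_mul (g h : G) : G :=
  aut_mk (comp_is_automorphism (aut_funP g) (aut_funP h)).

Let aut_inv_ex (g : G) :
  {h : G | cancel (aut_fun g) (aut_fun h) & cancel (aut_fun h) (aut_fun g)}.
Proof.
apply: cid2; have [h [hP gK hK]] := inv_is_automorphism (aut_funP g).
by exists (aut_mk hP).
Qed.

Definition aut_inv (g : G) : G := s2val (aut_inv_ex g).

Lemma aut_funK g : cancel (aut_fun g) (aut_fun (aut_inv g)).
Proof. exact: s2valP (aut_inv_ex g). Qed.

Lemma aut_funVK g : cancel (aut_fun (aut_inv g)) (aut_fun g).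
Proof. exact: s2valP' (aut_inv_ex g). Qed.

Let aut_mulA : associative aut_mul.
Proof. by move=> f g h; exact: aut_eqP. Qed.

Let aut_mul1 : left_id aut_one aut_mul.
Proof. by move=> g; exact: aut_eqP. Qed.

Let aut_mulr1 : right_id aut_one aut_mul.
Proof. by move=> g; exact: aut_eqP. Qed.

Let aut_mulV : left_inverse aut_one aut_inv aut_mul.
Proof. by move=> g; apply: aut_eqP => x; exact: aut_funK. Qed.

Let aut_mulrV : right_inverse aut_one aut_inv aut_mul.
Proof. by move=> g; apply: aut_eqP => x; exact: aut_funVK. Qed.

HB.instance Definition _ :=
  isGroup.Build G aut_mulA aut_mul1 aut_mulr1 aut_mulV aut_mulrV.

Lemma aut_continuous (X : topologicalType) (h : X -> G) :
  (forall x m, \forall y \near x, aut_fun (h y) m = aut_fun (h x) m) ->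
  continuous h.
Proof.
move=> hP; apply: continuous_comp_initial => x.
apply/cvg_sup => m U [_ [[W _ <-] /= Wx WU]].
by apply: filterS (hP x m) => y e; apply: WU; rewrite /= [_ m]e.
Qed.

Lemma near_aut (g : G) m : \forall h \near g, aut_fun h m = aut_fun g m.
Proof.
have val_cts : continuous (set_val : G -> {ptws M -> discrete_topology M}).
  exact: initial_continuous.
have proj_cts := @proj_continuous M (fun=> discrete_topology M) m.
have := proj_cts (set_val g) [set aut_fun g m] (discrete_set1 _).
exact: val_cts.
Qed.

Let aut_mul_continuous : continuous (fun xy : G * G => (xy.1 * xy.2)%g).
Proof.
apply: aut_continuous => -[g h] m.
have [] := (near_aut g (aut_fun h m), near_aut h m) => ng nh.
exists ([set g' | aut_fun g' (aut_fun h m) = aut_fun g (aut_fun h m)],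
        [set h' | aut_fun h' m = aut_fun h m]); first by split.
move=> [g' h'] [/= eg eh].
change (aut_fun g' (aut_fun h' m) = aut_fun g (aut_fun h m)).
by rewrite eh eg.
Qed.

Let aut_inv_continuous : continuous (fun x : G => (x^-1)%g).
Proof.
apply: aut_continuous => g m.
apply: filterS (near_aut g (aut_fun (aut_inv g) m)) => h /=.
rewrite aut_funVK => eh; rewrite -[X in aut_fun _ X = _]eh.
exact: aut_funK.
Qed.

HB.instance Definition _ :=
  isTopologicalGroup.Build G aut_mul_continuous aut_inv_continuous.

End AutGroup.

Coercion aut_fun : autgroup >-> Funclass.

Section AlgebraicClosure.
Context {M : choiceType} (S : structure M).

Definition pointwise_stabilizer (A : set M) : set (autgroup S) :=
  [set g | forall a, A a -> g a = a].

Definition acl (A : set M) : set M :=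
  [set x | finite_set [set g x | g in pointwise_stabilizer A]].

End AlgebraicClosure.

(* Main.v *)
Require Import Defs.
From HB Require Import structures.
From mathcomp Require Import all_boot all_order all_algebra.
From mathcomp Require Import all_classical topology.
From mathcomp Require Import zify.

(** Write [C] for a similarity class.  If [C] misses the comeager set of tuples
    generating a non-precompact, non-discrete group, it is meager.  Otherwise
    fix such a tuple [f0] in [C].  Since the group of [f0] is not discrete,
    there are nonempty reduced words [W k] such that [W k], and even all its
    conjugates by words of length at most [k], take values at [f0] tending to
    the identity ([small_words]).  Similarity transports this convergence
    to every tuple [g] of [C], so for each point [a] there is a [K] such that,
    for all [k >= K], these conjugates fix [a] at [g]
    ([similarity_class_pieces]).  On the other hand a group of automorphisms all
    of whose orbits are finite is precompact ([precompact_finite_orbits]), so a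
    generic [g] has a point [a] with an infinite orbit.  Hence, up to a meager
    set, [C] is covered by countably many sets [P (a, K)], consisting of the
    tuples for which both happen.

    Each [P (a, K)] is nowhere dense ([piece_nowhere_dense]).  Fixing a point
    under the value of a word is a closed condition, so if [P (a, K)] were dense
    near one of its members [g], then there would be a finite set [B], which may
    be replaced by its algebraic closure, such that for every tuple [h] agreeing
    with [g] on [B] the words above still fix [a].  The orbit of [a] under [g]
    is infinite, so some word carries [a] along [g] to a point at which the next
    letter [l] is no longer prescribed on [B] ([exit_word]).  From there on the
    tuple is free: a point outside the algebraic closure of the prescribed
    domain has infinitely many possible images, so that at each step the image
    can be chosen outside the closure of the domain of the next letter; along a
    reduced word, the path thus remains free and can be made to end outside any
    given finite set ([free_extension]).  It remains to conjugate [W k] by a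
    word that begins with this exit and does not cancel against [W k]: with at
    least two generators one additional letter prevents all cancellation
    ([reduced_conjugate]), and the resulting reduced word moves [a] for a
    suitable [h], a contradiction.  With a single generator, the word [W K] is a
    nonzero power of it that fixes [a], so that the orbit of [a] would be finite
    ([orbit_one_letter]). *)

Set Implicit Arguments.
Unset Strict Implicit.
Unset Printing Implicit Defensive.

Local Open Scope classical_set_scope.

(** * Meager sets *)

Section Meager.
Context {T : topologicalType}.
Implicit Types A B : set T.

Lemma meagerS A B : A `<=` B -> meager B -> meager A.
Proof.
move=> AB [F Fnd BF]; exists (fun i => F i `&` A).
  move=> i; apply/seteqP; split=> // x.
  rewrite -(Fnd i); apply: interiorS; apply: closureS; exact: subIsetl.
rewrite -setI_bigcupl -BF; apply/seteqP; split=> [x Ax|x []//].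
by split=> //; exact: AB.
Qed.

Lemma nowhere_dense_meager A : nowhere_dense A -> meager A.
Proof.
move=> And; exists (fun=> A) => //; apply/seteqP.
by split=> [x Ax|x [i _]//]; exists 0%N.
Qed.

Lemma meager_bigcup (I : countType) (A : I -> set T) :
  (forall i, meager (A i)) -> meager (\bigcup_i A i).
Proof.
move=> /(_ _)/cid2-/all_sig2[F Fnd AF].
have nd0 : nowhere_dense (set0 : set T).
  by rewrite /nowhere_dense closure0 interior0.
exists (fun m => if unpickle m is Some (i, j) then F i j else set0).
  by move=> m; case: unpickle => [[i j]|].
apply/seteqP; split=> x.
  move=> [i _]; rewrite AF => -[j _ Fx].
  by exists (pickle (i, j)) => //; rewrite pickleK.
move=> [m _]; case: unpickle => [[i j] Fx|//].
by exists i => //; rewrite AF; exists j.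
Qed.

Lemma meagerU A B : meager A -> meager B -> meager (A `|` B).
Proof.
move=> Am Bm; rewrite -bigcup2E.
apply: meager_bigcup => -[|[|i]] //=.
by apply: nowhere_dense_meager; rewrite /nowhere_dense closure0 interior0.
Qed.

End Meager.

(** * Finiteness and filters *)

Lemma filter_finite {I : eqType} {T : Type} {F : set_system T} {FF : Filter F}
    (A : set I) (P : I -> set T) :
  finite_set A -> (forall i, A i -> F (P i)) ->
  F [set x | forall i, A i -> P i x].
Proof.
move=> /finite_seqP[s ->]; elim: s => [|i s IHs] FP.
  by apply: filterS filterT.
apply: filterS (filterI (FP i (mem_head i s)) (IHs _)) => [x [Pi Ps] j /=|].
  by rewrite inE => /predU1P[->//|/Ps].
by move=> j js; apply: FP => /=; rewrite inE js orbT.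
Qed.

Lemma ultra_finite_fiber {T : Type} {U : eqType} {F : set_system T}
    {FU : UltraFilter F} (h : T -> U) (B : set U) :
  finite_set B -> F (h @^-1` B) -> exists b, F [set x | h x = b].
Proof.
move=> /finite_seqP[s ->]; elim: s => [|b s IHs] Fs.
  by have /filter_ex[] : F set0 by apply: filterS Fs.
have [Fb|FNb] := in_ultra_setVsetC [set x | h x = b] FU; first by exists b.
apply: IHs; apply: filterS (filterI FNb Fs) => x [/= hxb].
by rewrite inE => /predU1P[].
Qed.

(** * The pointwise topology on an automorphism group *)

Section AutTopology.
Context {M : choiceType} {S : structure M}.
Local Notation G := (autgroup S).

Lemma aut_mulE (g h : G) m : (g * h : G)%g m = g (h m).
Proof. by []. Qed.

Lemma aut_invK (g : G) : cancel g (g^-1 : G)%g.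
Proof. exact: aut_funK. Qed.

Lemma aut_invVK (g : G) : cancel (g^-1 : G)%g g.
Proof. exact: aut_funVK. Qed.

Lemma near_aut_inv (g : G) m :
  \forall h \near g, (h^-1 : G)%g m = (g^-1 : G)%g m.
Proof.
by have /(_ _ (near_aut (g^-1)%g m)) := @invg_continuous G g.
Qed.

Lemma cvg_aut (F : set_system G) (g : G) : Filter F ->
  (forall m, F [set h : G | h m = g m]) -> F --> g.
Proof.
move=> FF Fg A [_ [[B Bop <-] Bg BA]].
rewrite nbhs_filterE; apply: filterS BA _.
suff /(_ B) : set_val @ F --> (set_val g : {ptws M -> discrete_topology M}).
  by apply; apply: open_nbhs_nbhs.
apply/cvg_sup => m U [_ [[W _ <-] /= Wg WU]].
rewrite nbhs_filterE /fmap /=; apply: filterS (Fg m) => h hg.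
by apply: WU; rewrite /= [_ m]hg.
Qed.

(** The sets of automorphisms agreeing with [g] on a finite set generate a
    filter which converges to [g] by [cvg_aut]; convergence of this filter is
    exactly the claim that these sets form a basis at [g]. *)
Lemma nbhs_aut (g : G) (V : set G) : nbhs g V ->
  exists2 B : set M, finite_set B & [set h : G | {in B, h =1 g}] `<=` V.
Proof.
pose F : set_system G :=
  filter_from finite_set (fun B : set M => [set h : G | {in B, h =1 g}]).
have FF : Filter F.
  apply: filter_from_filter; first by exists set0.
  move=> A B fA fB; exists (A `|` B); first by rewrite finite_setU.
  by move=> h /= hAB; split=> m mA; apply: hAB; rewrite in_setU mA ?orbT.
apply: (@cvg_aut F g _ _ V) => m; exists [set m]; first exact: finite_set1.
by move=> h /= ->//; rewrite inE.
Qed.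

Lemma nbhs_aut_tuple n (g : {ptws 'I_n -> G}) (V : set {ptws 'I_n -> G}) :
  nbhs g V -> exists2 B : set M, finite_set B &
    [set h : {ptws 'I_n -> G} |
      forall i, {in B, (h i : G) =1 (g i : G)}] `<=` V.
Proof.
pose F : set_system {ptws 'I_n -> G} := filter_from finite_set
  (fun B : set M => [set h : {ptws 'I_n -> G} |
     forall i, {in B, (h i : G) =1 (g i : G)}]).
have FF : Filter F.
  apply: filter_from_filter; first by exists set0.
  move=> A B fA fB; exists (A `|` B); first by rewrite finite_setU.
  by move=> h /= hAB; split=> i m mA; apply: hAB; rewrite in_setU mA ?orbT.
suff /(_ V) : F --> g by [].
apply/cvg_sup => i U [_ [[W Wop <-] /= Wg WU]].
have [B fB BW] : exists2 B : set M, finite_set B &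
      [set h : G | {in B, h =1 g i}] `<=` W.
  by apply: nbhs_aut; exact: open_nbhs_nbhs.
by exists B => // h /= hB; apply: WU; apply: BW; exact: hB.
Qed.

Lemma near_aut_tuple n (g : {ptws 'I_n -> G}) i m :
  \forall h \near g, (h i : G) m = g i m.
Proof.
have /(_ [set h : G | h m = g i m]) := @proj_continuous _ (fun=> G) i g.
by apply; exact: near_aut.
Qed.

(** Along an ultrafilter, a map with values in a finite set is eventually
    constant; this defines the limit pointwise.  Controlling the inverses as
    well makes the limit surjective, and each instance of the axioms of an
    automorphism involves finitely many points, hence is inherited from some
    automorphism of the filter. *)
Lemma aut_ultra_limit (F : set_system G) : UltraFilter F ->
  (forall m, exists2 B : set M, finite_set B &
     F [set h : G | B (h m) /\ B ((h^-1 : G)%g m)]) ->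
  exists g : G, F --> g.
Proof.
move=> FU Fb.
have meet (P Q : set G) : F P -> F Q -> exists h : G, P h /\ Q h.
  move=> FP FQ; have PF : ProperFilter F by exact: ultra_proper.
  by apply: (@filter_ex _ F PF); apply: filterI.
have /choice[u Fu] : forall m, exists b, F [set h : G | h m = b].
  move=> m; have [B fB FB] := Fb m; apply: (ultra_finite_fiber fB).
  by apply: filterS FB => h [].
have /choice[v Fv] : forall m, exists b, F [set h : G | (h^-1 : G)%g m = b].
  move=> m; have [B fB FB] := Fb m; apply: (ultra_finite_fiber fB).
  by apply: filterS FB => h [].
have uP : is_automorphism S u.
  have Ft k (t : 'I_k -> M) : F [set h : G | h \o t = u \o t].
    have Fut : F [set h : G | forall i, h (t i) = u (t i)].
      by apply: filter_forall => i; exact: Fu.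
    by apply: filterS Fut => h ht; apply/funext => i; exact: ht.
  split.
  - exists v => m.
      have [h [/= hm hum]] := meet _ _ (Fu m) (Fv (u m)).
      by rewrite -hum -hm; exact: aut_invK.
    have [h [/= hm hum]] := meet _ _ (Fv m) (Fu (v m)).
    by rewrite -hum -hm; exact: aut_invVK.
  - move=> r t; have [h [<- _]] := meet _ _ (Ft _ t) (Ft _ t).
    by have [_ hr _] := aut_funP h; exact: hr.
  - move=> s t; have [h [/= <- <-]] := meet _ _ (Ft _ t) (Fu (fun_interp t)).
    by have [_ _ hf] := aut_funP h; exact: hf.
by exists (aut_mk uP); exact: cvg_aut.
Qed.

(** The closed set of the witness consists of the automorphisms that, together
    with their inverses, map each point into its orbit under [H]. *)
Lemma precompact_finite_orbits (H : set G) : is_subgroup H ->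
  (forall m, finite_set [set h m | h in H]) -> precompact H.
Proof.
move=> [_ _ HV] fH; pose O m := [set h m | h in H].
exists [set h : G | forall m, O m (h m) /\ O m ((h^-1 : G)%g m)].
  by move=> h Hh m; split; [exists h|exists (h^-1)%g => //; exact: HV].
set K := [set h | _].
have clK : closed K.
  move=> g clg m.
  have [h [Kh]] : K `&` [set h : G |
      h m = (g : G) m /\ (h^-1 : G)%g m = (g^-1 : G)%g m] !=set0.
    apply: clg; apply: filterI; first exact: near_aut.
    exact: near_aut_inv.
  by case=> <- <-; exact: Kh.
split=> //; rewrite compact_ultra => F FU FK.
have [g Fg] : exists g : G, F --> g.
  apply: aut_ultra_limit => m; exists (O m); first exact: fH.
  by apply: filterS FK => h; apply.
exists g; split=> //; apply: clK => V /Fg FV.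
have PF : ProperFilter F by exact: ultra_proper.
by apply: (@filter_ex _ F PF); apply: filterI.
Qed.

(** By translation, every point of a subgroup is isolated as soon as the
    identity is. *)
Lemma discrete_isolated_one (H : set G) (A : set M) : is_subgroup H ->
  finite_set A -> (forall h, H h -> {in A, h =1 id} -> h = 1%g) ->
  discrete_subset H.
Proof.
move=> [_ HM HV] fA Hiso U; rewrite openE => x Ux.
pose x0 : G := set_val x.
have nx : \forall y \near x0, {in A, (y : G) =1 x0}.
  apply: filterS (filter_finite fA (fun m _ => near_aut x0 m)).
  by move=> y yx m /set_mem; exact: yx.
have vcts : continuous (set_val : H -> G) by exact: initial_continuous.
have {nx} : \forall y \near x, {in A, (set_val y : G) =1 x0}.
  exact: vcts nx.
apply: filterS => y yx; suff -> : y = x by [].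
pose y0 : G := set_val y.
have Hval (z : H) : H (set_val z) by exact: set_mem (valP z).
have : (y0^-1 * x0 = 1)%g.
  apply: Hiso; first exact: HM (HV _ (Hval y)) (Hval x).
  by move=> m mA; rewrite aut_mulE -yx// aut_invK.
move=> /(congr1 (fun z => y0 * z)%g); rewrite mulVKg mulg1 => xy.
by apply: val_inj.
Qed.

End AutTopology.

(** * Group words *)

Section Words.
Context {n : nat}.

Definition letter : finType := ('I_n * bool)%type.

Definition inv_letter (l : letter) : letter := (l.1, ~~ l.2).

Definition reduced : pred (seq letter) := sorted (fun l m => m != inv_letter l).

Definition inv_word (w : seq letter) := rev (map inv_letter w).

Lemma inv_letterK : involutive inv_letter.
Proof. by case=> i b; rewrite /inv_letter /= negbK. Qed.

Lemma inv_letter_neq l : inv_letter l != l.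
Proof. by case: l => i []; rewrite xpair_eqE andbF. Qed.

Lemma inv_word_rcons w l : inv_word (rcons w l) = inv_letter l :: inv_word w.
Proof. by rewrite /inv_word map_rcons rev_rcons. Qed.

Lemma reduced_inv_word w : reduced (inv_word w) = reduced w.
Proof.
rewrite /reduced rev_sorted sorted_map; apply: eq_sorted => l m /=.
by rewrite inv_letterK eq_sym.
Qed.

Lemma reduced_cat u v l : reduced (rcons u l) -> reduced v ->
  head l v != inv_letter l -> reduced (rcons u l ++ v).
Proof.
case: v => [|m v]; first by rewrite cats0.
move=> ru rv /= ml; rewrite /reduced.
case: u ru => [|k u] /=; first by rewrite ml.
by rewrite cat_path last_rcons /= => -> /=; rewrite ml.
Qed.

Lemma reduced_catl u v : reduced (u ++ v) -> reduced u.
Proof. by case: u => //= l u; rewrite cat_path => /andP[]. Qed.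

Context {G : topGroupType}.
Local Open Scope group_scope.

Definition letter_val (g : 'I_n -> G) (l : letter) : G :=
  if l.2 then g l.1 else (g l.1)^-1.

(** The head of a word is the letter that acts first, so that the induction on
    words follows the path of a point. *)
Fixpoint word_val (g : 'I_n -> G) (w : seq letter) : G :=
  if w is l :: w' then word_val g w' * letter_val g l else 1.

Variable g : 'I_n -> G.

Lemma letter_val_inv l : letter_val g (inv_letter l) = (letter_val g l)^-1.
Proof. by case: l => i [] //=; rewrite /letter_val /= invgK. Qed.

Lemma word_val_cat u v : word_val g (u ++ v) = word_val g v * word_val g u.
Proof. by elim: u => [|l u IHu] /=; rewrite ?mulg1// IHu mulgA. Qed.

Lemma word_val_inv w : word_val g (inv_word w) = (word_val g w)^-1.
Proof.
elim: w => [|l w IHw] /=; first by rewrite invg1.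
rewrite /inv_word /= rev_cons -cats1 word_val_cat IHw /= mul1g.
by rewrite letter_val_inv invgM.
Qed.

(** Adding a letter to a reduced word either keeps it reduced or cancels its
    first letter. *)
Lemma word_val_reduced w : exists2 u, reduced u & word_val g u = word_val g w.
Proof.
elim: w => [|l w [u ru uw]]; first by exists [::].
case: u ru uw => [|m u] ru uw; first by exists [:: l]; rewrite //= -uw.
have [ml|ml] := eqVneq m (inv_letter l); last first.
  by exists [:: l, m & u]; rewrite /= -?uw //; apply/andP.
exists u; first by case: (u) ru => //= k v /andP[].
by rewrite /= -uw /= ml letter_val_inv mulgVK.
Qed.

Lemma gen_subgroup_is_subgroup : is_subgroup (gen_subgroup g).
Proof.
split=> [H [[]]|x y gx gy H HP|x gx H HP] //; have [[_ HM HV] _] := HP.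
  by apply: HM; [exact: gx|exact: gy].
by apply: HV; exact: gx.
Qed.

Lemma word_val_gen w : gen_subgroup g (word_val g w).
Proof.
have [g1 gM gV] := gen_subgroup_is_subgroup.
have gi i : gen_subgroup g (g i) by apply: sub_gen_smallest; exists i.
elim: w => //= -[i b] w IHw; apply: gM => //.
by rewrite /letter_val /=; case: b => //; exact: gV.
Qed.

Lemma gen_subgroupP x :
  gen_subgroup g x <-> exists2 w, reduced w & word_val g w = x.
Proof.
split=> [|[w _ <-]]; last exact: word_val_gen.
suff : gen_subgroup g `<=` range (word_val g).
  by move=> /[apply] -[w _ <-]; exact: word_val_reduced.
apply: smallest_sub => [|_ [i _ <-]]; last first.
  by exists [:: (i, true)] => //=; rewrite mul1g.
split; first by exists [::].
  by move=> _ _ [u _ <-] [v _ <-]; exists (v ++ u) => //; rewrite word_val_cat.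
by move=> _ [u _ <-]; exists (inv_word u) => //; rewrite word_val_inv.
Qed.

Lemma word_val_morph (h : 'I_n -> G) (phi : G -> G) w :
  {in gen_subgroup g &, {morph phi : x y / x * y}} ->
  (forall i, phi (g i) = h i) -> phi (word_val g w) = word_val h w.
Proof.
move=> phiM phig; have [g1 _ gV] := gen_subgroup_is_subgroup.
have gi i : gen_subgroup g (g i) by apply: sub_gen_smallest; exists i.
have phi1 : phi 1 = 1.
  by apply: (@mulgI G (phi 1) (phi 1) 1); rewrite -phiM ?mulg1; rewrite // inE.
elim: w => //= -[i b] w IHw.
have gl : gen_subgroup g (letter_val g (i, b)).
  by rewrite /letter_val; case: b => /=; [exact: gi|exact: gV (gi i)].
rewrite phiM ?IHw; [|by rewrite inE; exact: word_val_gen|by rewrite inE].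
congr (_ * _); case: b {gl}; rewrite /letter_val /=; first exact: phig.
apply: (@mulgI G (h i)); rewrite mulgV -phig -phiM ?mulgV//; rewrite inE//.
exact: gV (gi i).
Qed.

End Words.

Section Conjugates.
Context {n : nat}.
Local Notation letter := (@letter n).

Lemma reduced_catr (u v : seq letter) : reduced (u ++ v) -> reduced v.
Proof.
elim: u => //= l u IHu ruv; apply: IHu.
by case: (u ++ v) ruv => //= m w /andP[].
Qed.

Lemma letter_avoid (s : seq letter) : size s < n.*2 -> exists l, l \notin s.
Proof.
move=> sn; apply/existsP; apply: contraTT sn; rewrite negb_exists -leqNgt.
move=> /forallP ns.
rewrite (leq_trans _ (card_size s))//.
have <- : #|{: letter}| = n.*2 by rewrite card_prod card_ord card_bool muln2.
apply: subset_leq_card; apply/fintype.subsetP => l _.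
by have := ns l; rewrite negbK.
Qed.

(** Cancellation in the conjugate can occur at three places only: after the
    letter [l], and at both ends of [w].  Each excludes one choice of the
    additional letter, and two generators provide four letters. *)
Lemma reduced_conjugate (u w : seq letter) l : 2 <= n -> reduced (rcons u l) ->
  reduced w -> w != [::] -> exists m, let v := rcons (rcons u l) m in
    reduced (v ++ w ++ inv_word v).
Proof.
move=> n2 ru rw w0.
have [|m] := @letter_avoid [:: inv_letter l; inv_letter (head l w); last l w].
  by rewrite (@leq_trans 4)// -[4]/(2.*2) leq_double.
rewrite !inE !negb_or => /and3P[ml mh mt]; exists m => /=.
have rv : reduced (rcons (rcons u l) m).
  by rewrite -cats1; apply: reduced_cat.
apply: reduced_cat => //; last first.
  case: w w0 mh {mt rw} => //= k w _ mk; apply: contra_neq mk => ->.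
    by rewrite inv_letterK.
case/lastP: w w0 rw mt {mh} => // w k _ rw; rewrite last_rcons => mk.
apply: reduced_cat => //; first by rewrite reduced_inv_word.
by rewrite inv_word_rcons /=; apply: contra_neq mk => /(can_inj inv_letterK).
Qed.

Lemma eq_or_inv_letter (l m : letter) : n < 2 -> m = l \/ m = inv_letter l.
Proof.
move=> n2; have ij (i j : 'I_n) : i = j.
  by apply: val_inj => /=; have := ltn_ord i; have := ltn_ord j; lia.
case: l m => [i b] [j b']; rewrite (ij j i) /inv_letter /=.
by case: b b' => [] []; [left|right|right|left].
Qed.

Lemma reduced_one_letter (l : letter) w : n < 2 -> reduced (l :: w) ->
  w = nseq (size w) l.
Proof.
move=> n2; elim: w => //= m w IHw /andP[ml rw].
have [ml'|ml'] := eq_or_inv_letter l m n2; last by rewrite ml' eqxx in ml.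
by rewrite ml' -IHw//; rewrite ml' in rw.
Qed.

End Conjugates.

(** * Words under topological similarity *)

Section Similarity.
Context {M : choiceType} {S : structure M} {n : nat}.
Local Notation G := (autgroup S).

Lemma within_continuous_at_one (H : set G) (phi : G -> G) m :
  is_subgroup H -> {within H, continuous phi} -> phi 1%g = 1%g ->
  exists2 A : set M, finite_set A &
    forall h, H h -> {in A, h =1 id} -> phi h m = m.
Proof.
move=> [H1 _ _] /subspace_continuousP/(_ 1%g H1) phic phi1.
have Fphi : within H (nbhs 1%g) [set h | phi h m = phi 1%g m].
  exact: (phic _ (near_aut (phi 1%g) m)).
have [A fA AH] := nbhs_aut Fphi.
by exists A => // h Hh hA; rewrite (AH h)// phi1.
Qed.

(** Bicontinuity at the identity, in terms of words: words whose values at one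
    tuple are close to the identity have values close to the identity at the
    other one. *)
Lemma similarity_words (f g : {ptws 'I_n -> G}) : similarity_class f g ->
  (forall m, exists2 A : set M, finite_set A & forall w,
     {in A, (word_val f w : G) =1 id} -> (word_val g w : G) m = m) /\
  (forall m, exists2 A : set M, finite_set A & forall w,
     {in A, (word_val g w : G) =1 id} -> (word_val f w : G) m = m).
Proof.
move=> [phi [_ phiM phic [psi phiK psic]] phif].
have phiw w : phi (word_val f w) = word_val g w by exact: word_val_morph.
have psiw w : psi (word_val g w) = word_val f w.
  by rewrite -phiw phiK// inE; exact: word_val_gen.
split=> m.
  have [A fA AH] := within_continuous_at_one m (gen_subgroup_is_subgroup _)
    phic (phiw [::]).
  by exists A => // w /AH; rewrite phiw; apply; exact: word_val_gen.
have [A fA AH] := within_continuous_at_one m (gen_subgroup_is_subgroup _)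
  psic (psiw [::]).
by exists A => // w /AH; rewrite psiw; apply; exact: word_val_gen.
Qed.

Lemma near_word_val (g : {ptws 'I_n -> G}) w m :
  \forall h \near g, (word_val h w : G) m = (word_val g w : G) m.
Proof.
elim: w m => [|[i b] w IHw] m; first by apply: (@nearW _ (nbhs g)).
have near_l : \forall h \near g,
    (letter_val h (i, b) : G) m = (letter_val g (i, b) : G) m.
  case: b; first exact: near_aut_tuple.
  have /(_ _ (near_aut_inv (g i) m)) := @proj_continuous _ (fun=> G) i g.
  by [].
have near_w := IHw ((letter_val g (i, b) : G) m).
have FF : Filter (nbhs g) := nbhs_filter g.
have := @filterI _ _ FF _ _ near_l near_w.
apply: (@filterS _ _ FF) => h [/= hl hw].
by rewrite !aut_mulE hl hw.
Qed.

End Similarity.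

(** * Algebraic closure *)

Section AlgebraicClosureTheory.
Context {M : choiceType} {S : structure M}.
Local Notation G := (autgroup S).
Local Notation Stab := (@pointwise_stabilizer M S).
Implicit Types A : set M.

Lemma sub_acl A : A `<=` acl S A.
Proof.
move=> x Ax; apply: sub_finite_set (finite_set1 x) => _ [g gA <-] /=; exact: gA.
Qed.

(** Each point of [s] has finitely many images, hence so has the whole
    sequence. *)
Lemma finite_restrictions A (s : seq M) : {in s, forall x, acl S A x} ->
  finite_set [set map g s | g in Stab A].
Proof.
elim: s => [|x s IHs] sA.
  by apply: sub_finite_set (finite_set1 [::]) => _ [g _ <-].
have fx : finite_set [set g x | g in Stab A] by apply: (sA x); exact: mem_head.
have {}IHs : finite_set [set map g s | g in Stab A].
  by apply: IHs => y ys; apply: sA; rewrite inE ys orbT.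
apply: sub_finite_set (finite_image2 cons fx IHs) => _ [g gA <-] /=.
by exists (g x); [exists g|exists (map g s); [exists g|]].
Qed.

(** The stabilizer of [acl S A] has finite index in that of [A]: an element
    [g] of the latter is determined modulo the former by its restriction to the
    finite set [acl S A], and finitely many restrictions occur.  So the orbit
    of [x] under the stabilizer of [A] is a finite union of translates of its
    orbit under that of [acl S A]. *)
Lemma acl_acl A : finite_set (acl S A) -> acl S (acl S A) `<=` acl S A.
Proof.
move=> /finite_seqP[s As] x fx.
have fT : finite_set [set map g s | g in Stab A].
  by apply: finite_restrictions => y ys; rewrite As.
have /choice[rep repP] : forall t, exists r : G,
    (exists2 g, Stab A g & map g s = t) -> Stab A r /\ map r s = t.
  move=> t; have [[g gA gt]|no] := pselect (exists2 g, Stab A g & map g s = t).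
    by exists g.
  by exists 1%g => /no.
(* [rep t] is an element of the stabilizer of [A] with restriction [t]. *)
pose orb t := [set rep t y | y in [set h x | h in Stab (acl S A)]].
apply: (@sub_finite_set _ _ (\bigcup_(t in [set map g s | g in Stab A]) orb t)).
  move=> _ [g gA <-]; exists (map g s); first by exists g.
  have [rA rs] := repP (map g s) (ex_intro2 _ _ g gA erefl).
  exists (((rep (map g s))^-1 * g : G)%g x); last by rewrite aut_mulE aut_invVK.
  exists ((rep (map g s))^-1 * g)%g => // y; rewrite As /= => ys.
  have := congr1 (fun t => nth y t (index y s)) rs.
  rewrite !(nth_map y) ?index_mem// nth_index// => ry.
  by rewrite aut_mulE -ry aut_invK.
apply: bigcup_finite => // t _; by apply: finite_image.
Qed.

Lemma acl_image A (g : G) : acl S (g @` A) `<=` g @` acl S A.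
Proof.
move=> y fy; exists ((g^-1 : G)%g y); last exact: aut_invVK.
apply: sub_finite_set (finite_image ((g^-1 : G)%g) fy) => _ [h hA <-].
exists ((g * (h * g^-1) : G)%g y); last by rewrite !aut_mulE aut_invK.
exists (g * (h * g^-1))%g => // _ [x Ax <-].
by rewrite !aut_mulE aut_invK hA.
Qed.

Lemma acl_avoid A (F : set M) x : ~ acl S A x -> finite_set F ->
  exists2 s : G, Stab A s & ~ F (s x).
Proof.
move=> nAx fF; apply: contrapT => no; apply: nAx; apply: sub_finite_set fF.
by move=> _ [s sA <-]; apply: contrapT => nF; apply: no; exists s.
Qed.

End AlgebraicClosureTheory.

(** * Extending partial automorphisms along a word *)

Section PartialAutomorphisms.
Context {M : choiceType} {S : structure M} {n : nat}.
Local Notation G := (autgroup S).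
Local Notation letter := (@letter n).
Implicit Types (g h : 'I_n -> G) (D : 'I_n -> set M).
Implicit Types (l m : letter) (w : seq letter) (x c : M).

Definition agree g D h := forall i, {in D i, h i =1 g i}.

(** When the values of [g i] on [D i] are prescribed, the values of its inverse
    are prescribed on the image of [D i]. *)
Definition letter_dom g D l : set M :=
  if l.2 then D l.1 else g l.1 @` D l.1.

Local Notation lval g l := (letter_val g l : G).
Local Notation wval g w := (word_val g w : G).

Lemma letter_dom_finite g D l :
  (forall i, finite_set (D i)) -> finite_set (letter_dom g D l).
Proof. by rewrite /letter_dom; case: ifP => _ fD; last exact: finite_image. Qed.

Lemma agree_letter g D h l x : agree g D h ->
  letter_dom g D l x -> lval h l x = lval g l x.
Proof.
case: l => i []; rewrite /letter_dom /letter_val /= => gh.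
  by move=> Dx; apply: gh; rewrite inE.
move=> [y Dy <-]; rewrite aut_invK -(gh i y) ?aut_invK//; by rewrite inE.
Qed.

Lemma agree_trans g D g' D' h : (forall i, D i `<=` D' i) ->
  agree g D g' -> agree g' D' h -> agree g D h.
Proof.
move=> DD' gg' g'h i x; rewrite inE => Dx.
by rewrite g'h ?gg' ?inE//; exact: DD'.
Qed.

Lemma letter_dom_val g D l x :
  letter_dom g D l x -> letter_dom g D (inv_letter l) (lval g l x).
Proof.
case: l => i []; rewrite /letter_dom /letter_val /=; first by exists x.
by move=> [y Dy <-]; rewrite aut_invK.
Qed.

(** Composing the letter [l] with an automorphism [s] that fixes its prescribed
    domain keeps the prescribed values, and moves the image of [c] away from
    [X].  Prescribing this new value adds [c] to the domain of [l]; the one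
    domain that depends on the choice of [s] is that of the inverse letter. *)
Lemma extend_one_letter g D l c (X : set M) :
  (forall i, finite_set (D i)) -> ~ acl S (letter_dom g D l) c ->
  finite_set X ->
  exists g' D', [/\ forall i, finite_set (D' i), forall i, D i `<=` D' i,
    agree g D g',
    forall m, m != inv_letter l -> letter_dom g' D' m =
      if m == l then c |` letter_dom g D l else letter_dom g D m &
    ~ X (lval g' l c)].
Proof.
move=> fD nc fX.
have [s sD nX] := acl_avoid nc (finite_image ((lval g l)^-1 : G)%g fX).
have {}nX : ~ X (lval g l (s c)).
  by move=> Xc; apply: nX; exists (lval g l (s c)) => //; exact: aut_invK.
pose gi : G := if l.2 then (g l.1 * s)%g else (s^-1 * g l.1)%g.
pose g' i := if i == l.1 then gi else g i.
have g'l : lval g' l = (lval g l * s)%g.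
  rewrite /letter_val /g' eqxx /gi; case: (l.2) => //.
  by rewrite invgM invgK.
pose d := if l.2 then c else lval g' l c.
pose D' i := if i == l.1 then d |` D i else D i.
have gg' : agree g D g'.
  move=> i x; rewrite inE /g' /gi => Dx; case: eqP => // il.
  move: sD; rewrite /letter_dom -il; case: ifP => _ sD; rewrite aut_mulE.
    by rewrite sD.
  by rewrite -[X in (s^-1 : G)%g X]sD ?aut_invK//; exists x.
exists g', D'; split=> //.
- by move=> i; rewrite /D'; case: ifP => // _; rewrite finite_setU; split.
- by move=> i x Dx; rewrite /D'; case: ifP => // _; right.
- have gD i : g' i @` D i = g i @` D i.
    by apply: eq_imagel => x Dx; rewrite gg'// inE.
  move=> m ml; rewrite /letter_dom /D'.
  have [m1|m1] := eqVneq m.1 l.1; last first.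
    have -> : (m == l) = false by apply/eqP => ml'; rewrite ml' eqxx in m1.
    by rewrite gD.
  have m2 : m.2 = l.2.
    move: ml m1; case: m => i b; case: (l) => j b' /= + ij.
    by rewrite /inv_letter xpair_eqE /= ij eqxx; case: b b' => -[].
  have -> : m = l by case: (m) (l) m1 m2 => [? ?] [? ?] /= -> ->.
  rewrite !eqxx /d; case: ifP => l2; rewrite l2 //.
  rewrite image_setU gD; congr (_ `|` _).
  rewrite image_set1; congr set1; rewrite /letter_val l2; exact: aut_invVK.
- by rewrite g'l.
Qed.

Hypothesis acl_finite : forall A : set M, finite_set A -> finite_set (acl S A).

(** The image of [c] under the first letter is chosen outside the closure of
    the domain that the next letter has once this image is prescribed.  That
    domain does not depend on the image itself because the next letter is not
    the inverse of the first, so there are infinitely many images to choose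
    from. *)
Lemma free_extension w g D l c (F : set M) :
  (forall i, finite_set (D i)) -> reduced (l :: w) ->
  ~ acl S (letter_dom g D l) c -> finite_set F ->
  exists2 h, agree g D h & ~ F (wval h (l :: w) c).
Proof.
elim: w => [|m w IHw] in g D l c *.
  move=> fD _ nc fF.
  have [g' [D' [_ _ gg' _ nF]]] := extend_one_letter fD nc fF.
  by exists g' => //=; rewrite mul1g.
move=> fD /= /andP[ml rw] nc fF.
(* The closure of the domain of [m] after [c] has been added to that of [l]. *)
pose X := acl S (if m == l then c |` letter_dom g D l else letter_dom g D m).
have fX : finite_set X.
  apply: acl_finite; case: ifP => _; last exact: letter_dom_finite.
  by rewrite finite_setU; split=> //; exact: letter_dom_finite.
have [g' [D' [fD' DD' gg' dom nX]]] := extend_one_letter fD nc fX.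
have [|h g'h nF] := IHw g' D' m (lval g' l c) fD' rw _ fF; first by rewrite dom.
exists h; first exact: agree_trans gg' g'h.
have lc : letter_dom g' D' l c.
  by rewrite dom ?eqxx; [left|rewrite eq_sym inv_letter_neq].
by move: nF => /=; rewrite !aut_mulE (agree_letter g'h lc).
Qed.

Fixpoint defined_along g D w x : Prop :=
  if w is l :: w' then letter_dom g D l x /\ defined_along g D w' (lval g l x)
  else True.

Lemma defined_along_rcons g D w l x : defined_along g D w x ->
  letter_dom g D l (wval g w x) -> defined_along g D (rcons w l) x.
Proof.
by elim: w x => [|m w IHw] x //= [mx wx] lx; split=> //; exact: IHw.
Qed.

Lemma agree_defined_along g D h w x : agree g D h ->
  defined_along g D w x -> wval h w x = wval g w x.
Proof.
move=> gh; elim: w x => //= l w IHw x [lx wx].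
by rewrite !aut_mulE (agree_letter gh)// IHw.
Qed.

Lemma defined_along_end g D w x : defined_along g D w x ->
  wval g w x = x \/ exists l, letter_dom g D l (wval g w x).
Proof.
elim: w x => [|l w IHw] x /=; first by left.
move=> [/letter_dom_val lx /IHw[wx|[m mx]]]; right; last by exists m.
by exists (inv_letter l); rewrite aut_mulE wx.
Qed.

Definition word_orbit g x : set M := range (fun w => wval g w x).

(** A path that never exits ends in the union of the finitely many finite
    prescribed domains, or at its origin. *)
Lemma exit_word g D x : (forall i, finite_set (D i)) ->
  ~ finite_set (word_orbit g x) -> exists w l,
  [/\ reduced (rcons w l), defined_along g D w x &
      ~ letter_dom g D l (wval g w x)].
Proof.
move=> fD norb; apply: contrapT => no; apply: norb.
have def w : reduced w -> defined_along g D w x.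
  elim/last_ind: w => // w l IHw rwl.
  have dw : defined_along g D w x.
    by apply: IHw; move: rwl; rewrite -cats1 => /reduced_catl.
  apply: defined_along_rcons => //; apply: contrapT => nl.
  by apply: no; exists w, l.
apply: (@sub_finite_set _ _ (x |` \bigcup_l letter_dom g D l)).
  move=> _ [w _ <-]; have [u ru <-] := word_val_reduced g w.
  have [->|[l lx]] := defined_along_end (def u ru); first by left.
  by right; exists l.
rewrite finite_setU; split=> //; apply: bigcup_finite => [|l _].
  exact: finite_finset.
exact: letter_dom_finite.
Qed.

End PartialAutomorphisms.

(** * The pieces covering a similarity class *)

Section Pieces.
Context {M : countType} {S : structure M} {n : nat}.
Local Notation G := (autgroup S).
Hypothesis acl_finite : forall A : set M, finite_set A -> finite_set (acl S A).

(** With one generator a nonempty reduced word is a nonzero power of a letter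
    [s], so the orbit of [x] is the finite cycle of [s] through [x]. *)
Lemma orbit_one_letter (g : 'I_n -> G) w x : n < 2 -> reduced w -> w != [::] ->
  (word_val g w : G) x = x -> finite_set (word_orbit g x).
Proof.
case: w => // l w n2 rlw _ /=; rewrite (reduced_one_letter n2 rlw).
set k := size w; pose s : G := letter_val g l.
have iterE j : (word_val g (nseq j l) : G) (s x) = iter j.+1 s x.
  elim: j (x) => //= j IHj y; rewrite aut_mulE.
  by rewrite IHj /= -iterSr.
rewrite aut_mulE iterE => sk.
apply: (@sub_finite_set _ _ [set iter j s x | j in `I_k.+1]); last first.
  exact/finite_image/finite_II.
move=> _ [w' _ <-].
set T := [set _ | _ in _].
have Ts y : T y -> T (s y).
  move=> [j jk <-]; have [jk'|jk'] := ltnP j k; first by exists j.+1.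
  exists 0 => //=; have -> : j = k by apply/eqP; rewrite eqn_leq jk' andbT.
  exact: esym sk.
have TsV y : T y -> T ((s^-1 : G)%g y).
  move=> [[|j] jk <-]; last by exists j; [exact: ltnW|rewrite /= aut_invK].
  exists k; rewrite /= ?ltnSn//.
  exact: etrans (esym (aut_invK s _)) (congr1 (s^-1 : G)%g sk).
have : T x by exists 0.
elim: w' (x) => //= m w' IHw y Ty; rewrite aut_mulE; apply: IHw.
have [->|->] := eq_or_inv_letter l m n2; first exact: Ts.
by rewrite letter_val_inv; exact: TsV.
Qed.

(** Tuples near a member [g] of the piece only have to agree with [g] on a
    finite set, so beyond this set they can be made to move [a] along the
    reduced word supplied by [reduced_conjugate]; yet a dense piece would force
    all of them to fix [a]. *)
Lemma piece_nowhere_dense (W : nat -> seq (@letter n)) (K : nat) (a : M) :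
  (forall k, reduced (W k) /\ W k != [::]) ->
  nowhere_dense [set g : {ptws 'I_n -> G} | ~ finite_set (word_orbit g a) /\
    forall k v, K <= k -> size v <= k ->
      (word_val g (v ++ W k ++ inv_word v) : G) a = a].
Proof.
move=> rW; set P := [set g | _]; apply/seteqP; split=> // g0 int_g0.
have [g [[ginf gW] clg]] : P `&` interior (closure P) !=set0.
  have : closure P g0 by exact: interior_subset.
  by apply; exact: nbhs_interior.
have [B fB BP] := nbhs_aut_tuple clg.
have fix_a h k v : (forall i, {in B, (h i : G) =1 (g i : G)}) ->
    K <= k -> size v <= k -> (word_val h (v ++ W k ++ inv_word v) : G) a = a.
  move=> hg Kk vk; have clh : closure P h by exact: BP.
  have [h' [[_ Ph'] h'h]] := clh _ (near_word_val h (v ++ W k ++ inv_word v) a).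
  by rewrite -h'h; exact: Ph'.
have n2 : 2 <= n.
  rewrite leqNgt; apply/negP => n2; apply: ginf; have [rWK WK0] := rW K.
  apply: (orbit_one_letter n2 rWK WK0).
  by have := gW K [::] (leqnn K) isT; rewrite /inv_word /= cats0.
pose D (i : 'I_n) := acl S B.
have fD i : finite_set (D i) by exact: acl_finite fB.
have aclD l : acl S (letter_dom g D l) `<=` letter_dom g D l.
  rewrite /letter_dom; case: ifP => _; first exact: acl_acl (acl_finite fB).
  by move=> x /acl_image[y /(acl_acl (acl_finite fB)) yB <-]; exists y.
have [u [l [rul ua nl]]] := exit_word fD ginf.
(* The conjugator is [u] followed by the exit letter and one more letter. *)
pose k := maxn K (size u).+2.
have [rWk Wk0] := rW k.
have [m] := reduced_conjugate n2 rul rWk Wk0.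
set v := rcons (rcons u l) m; move=> /= rv.
have vE : v ++ W k ++ inv_word v = u ++ l :: m :: W k ++ inv_word v.
  by rewrite /v !cat_rcons.
have nacl : ~ acl S (letter_dom g D l) ((word_val g u : G) a) by move/aclD.
have rl : reduced (l :: m :: W k ++ inv_word v).
  by move: rv; rewrite vE => /reduced_catr.
(* The path of [a] follows [u] as under [g], then leaves for good at [l]. *)
have [h gh ha] := free_extension acl_finite fD rl nacl (finite_set1 a).
apply: ha; rewrite -(agree_defined_along gh ua) -aut_mulE -word_val_cat -vE.
apply: fix_a; [|exact: leq_maxl|by rewrite !size_rcons leq_maxr].
by move=> i x xB; apply: gh; rewrite inE; apply: sub_acl; rewrite -inE.
Qed.

Lemma nonprecompact_orbit (g : 'I_n -> G) : ~ precompact (gen_subgroup g) ->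
  exists a, ~ finite_set (word_orbit g a).
Proof.
move=> npc; apply: contrapT => fin; apply: npc.
apply: precompact_finite_orbits (gen_subgroup_is_subgroup g) _ => a.
apply: (@sub_finite_set _ _ (word_orbit g a)).
  by move=> _ [x /gen_subgroupP[w _ <-] <-]; exists w.
by apply: contrapT => ninf; apply: fin; exists a.
Qed.

Lemma finite_small_words k : finite_set [set w : seq (@letter n) | size w <= k].
Proof.
apply: (@sub_finite_set _ _ (range (fun b : k.-bseq (@letter n) => bseqval b))).
  by move=> w /= wk; exists (Bseq wk).
apply: finite_image; exact: finite_finset.
Qed.

Lemma finite_small_points k : finite_set [set x : M | pickle x < k].
Proof.
apply: (@finite_preimage M nat `I_k pickle) (finite_II k).
by move=> x y _ _; exact: (pcan_inj pickleK).
Qed.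

(** A nontrivial element of the group fixing the finitely many images, under
    words of length at most [k], of the first [k] points: all its conjugates by
    such words fix the first [k] points.  That one word serves for all short
    conjugators at once makes it possible to choose the conjugator knowing the
    word. *)
Lemma small_words (f : 'I_n -> G) : ~ discrete_subset (gen_subgroup f) ->
  exists W : nat -> seq (@letter n), forall k, [/\ reduced (W k), W k != [::] &
    forall v x, size v <= k -> pickle x < k ->
      (word_val f (v ++ W k ++ inv_word v) : G) x = x].
Proof.
move=> nd; suff /choice[W WP] : forall k, exists w, [/\ reduced w, w != [::] &
    forall v x, size v <= k -> pickle x < k ->
      (word_val f (v ++ w ++ inv_word v) : G) x = x] by exists W.
move=> k; pose A := [set (word_val f v : G) x |
  v in [set v | size v <= k] & x in [set x | pickle x < k]].
have fA : finite_set A.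
  apply: finite_image2; first exact: finite_small_words.
  exact: finite_small_points.
apply: contrapT => no; apply: nd.
apply: (discrete_isolated_one (gen_subgroup_is_subgroup f) fA).
move=> _ /gen_subgroupP[w rw <-] wA; apply: contrapT => w1; apply: no.
exists w; split=> //; first by apply/eqP => w0; rewrite w0 in w1.
move=> v x vk xk; rewrite !word_val_cat !aut_mulE wA ?word_val_inv ?aut_invK//.
by rewrite inE; exists v => //; exists x.
Qed.

Lemma similarity_class_pieces (f g : {ptws 'I_n -> G}) W a :
  (forall k, forall v x, size v <= k -> pickle x < k ->
      (word_val f (v ++ W k ++ inv_word v) : G) x = x) ->
  (exists2 A : set M, finite_set A & forall w,
     {in A, (word_val f w : G) =1 id} -> (word_val g w : G) a = a) ->
  exists K, forall k v, K <= k -> size v <= k ->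
      (word_val g (v ++ W k ++ inv_word v) : G) a = a.
Proof.
move=> fW [_ /finite_seqP[s ->] sg]; exists (\max_(x <- s) (pickle x).+1)%N.
move=> k v Kk vk; apply: sg => x; rewrite inE /= => xs; apply: fW => //.
apply: leq_trans Kk.
exact: (@leq_bigmax_seq _ s xpredT (fun x => (pickle x).+1) x xs isT).
Qed.

End Pieces.

Theorem theorem4p3 (M : countType) (S : structure M) (n : nat)
    (S_lf : locally_finite S)
    (S_acl : forall A : set M, finite_set A -> finite_set (acl S A))
    (n_ge1 : (1 <= n)%N)
    (S_generic : comeager [set f : {ptws 'I_n -> autgroup S} |
       ~ precompact (gen_subgroup f) /\ ~ discrete_subset (gen_subgroup f)]) :
  forall f : {ptws 'I_n -> autgroup S}, meager (similarity_class f).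
Proof.
move=> f; move: S_generic; rewrite /comeager; set Q := [set f | _] => mQ.
have [[f0 [ff0 [_ ndf0]]]|no] :=
    pselect (similarity_class f `&` Q !=set0); last first.
  by apply: meagerS mQ => g fg Qg; apply: no; exists g.
have [W WP] := small_words ndf0.
pose P (aK : M * nat) := [set g : {ptws 'I_n -> autgroup S} |
  ~ finite_set (word_orbit g aK.1) /\ forall k v, aK.2 <= k -> size v <= k ->
    (word_val g (v ++ W k ++ inv_word v) : autgroup S) aK.1 = aK.1].
apply: (@meagerS _ _ (~` Q `|` \bigcup_aK P aK)); last first.
  apply: meagerU mQ (meager_bigcup _) => -[a K]; apply: nowhere_dense_meager.
  by apply: piece_nowhere_dense => // k; have [] := WP k.
move=> g fg; have [Qg|] := pselect (Q g); last by left.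
right; have [a infa] := nonprecompact_orbit Qg.1.
have [K PK] : exists K, forall k v, K <= k -> size v <= k ->
    (word_val g (v ++ W k ++ inv_word v) : autgroup S) a = a.
  apply: (@similarity_class_pieces _ _ _ f0).
    by move=> k; have [] := WP k.
  have [A fA fgA] := (similarity_words fg).1 a.
  have /choice[A0 A0P] : forall x, exists A0 : set M, finite_set A0 /\ forall w,
      {in A0, (word_val f0 w : autgroup S) =1 id} ->
      (word_val f w : autgroup S) x = x.
    by move=> x; have [A0 ? ?] := (similarity_words ff0).2 x; exists A0.
  exists (\bigcup_(x in A) A0 x).
    by apply: bigcup_finite => // x _; have [] := A0P x.
  move=> w wA; apply: fgA => x; rewrite inE => Ax.
  by apply: (A0P x).2 => y; rewrite inE => yx; apply: wA; rewrite inE; exists x.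
by exists (a, K).
Qed.
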